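(* Let $m\ge 1$ be an integer and let $W_m(n,k)$ be the Whitney numbers of the second kind of the Dowling lattice of rank $n$ associated to a finite group of order $m$. For $n\ge 0$ put $$D_m(n;q)=\sum_{k=0}^n W_m(n,k)q^k,\quad F_{m,1}(n;q)=\sum_{k=0}^n k!\,W_m(n,k)m^kq^k,\quad F_{m,2}(n;q)=\sum_{k=0}^n k!\,W_m(n,k)q^k.$$ Then each of the polynomial sequences $\{D_m(n;q)\}_{n\ge 0}$, $\{F_{m,1}(n;q)\}_{n\ge 0}$ and $\{F_{m,2}(n;q)\}_{n\ge 0}$ is strongly $q$-log-convex.
   Context: The Whitney numbers $W_m(n,k)$ depend only on $m,n,k$ and are determined (Dowling) by the recurrence $$W_m(n,k)=(1+mk)W_m(n-1,k)+W_m(n-1,k-1),\qquad n\ge k\ge 1,$$ together with the boundary conditions $W_m(n,n)=W_m(n,0)=1$ for $n\ge 0$ and $W_m(n,k)=0$ if $k>n$. For real polynomials, $f(q)\ge_q g(q)$ means that $f(q)-g(q)$ has only nonnegative coefficients. A sequence of real polynomials $\{f_n(q)\}_{n\ge 0}$ is strongly $q$-log-convex if $f_{l-1}(q)f_{n+1}(q)\ge_q f_l(q)f_n(q)$ for all integers $n\ge l\ge 1$. *)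

(* Defs.v *)
From HB Require Import structures.
From mathcomp Require Import all_boot all_order all_fingroup all_algebra.
From mathcomp Require Import reals.

Set Implicit Arguments.
Unset Strict Implicit.
Unset Printing Implicit Defensive.

Import Order.TTheory GRing.Theory Num.Theory.

(* Rank in a finite poset: the length of a longest chain ending at x, i.e. the
   largest number of elements in a chain of elements strictly below x. *)
Definition poset_rank_at (d : Order.disp_t) (T : finPOrderType d) (x : T) : nat :=
  \max_(C : {set T} |
        [forall y in C, forall z in C, (y >=< z)%O] &&
        [forall y in C, (y < x)%O]) #|C|.

Definition poset_rank (d : Order.disp_t) (T : finPOrderType d) : nat :=
  \max_(x : T) poset_rank_at x.

(* Whitney numbers of the second kind, indexed by corank, as is customary for
   Dowling lattices: the number of elements x with rank(x) = rank(T) - k. *)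
Definition whitney2 (d : Order.disp_t) (T : finPOrderType d) (k : nat) : nat :=
  #|[set x : T | poset_rank_at x + k == poset_rank T]|.

Section Dowling.
Variables (n : nat) (gT : finGroupType).

Definition translate (g : gT) (B : {set 'I_n * gT}) : {set 'I_n * gT} :=
  [set (x.1, (g * x.2)%g) | x in B].

(* A partial G-partition of {0, ..., n-1}: pairwise disjoint nonempty subsets A
   of {0, ..., n-1}, each with a class of maps a : A -> G up to left
   multiplication by G.  Such a class {g a | g in G} is represented by the graphs
   of all its members, so an element is the set P of all these graphs; a partial
   G-partition with k blocks is thus a set P with k * #|G| members.  Two members
   of P whose domains meet at i have translates sharing a point (i, g); trivIset
   then makes these equal, so distinct classes have disjoint domains.  The
   indices outside every domain form the zero block. *)
Definition is_partial_gpartition (P : {set {set 'I_n * gT}}) : bool :=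
  [&& trivIset P, set0 \notin P,
      [forall g : gT, forall B in P, translate g B \in P]
    & [forall B in P, forall x in B, forall y in B, (x.1 == y.1) ==> (x == y)]].

Record dowling : Type := Dowling {
  gblocks :> {set {set 'I_n * gT}};
  _ : is_partial_gpartition gblocks }.

HB.instance Definition _ := [isSub for gblocks].
HB.instance Definition _ := [Finite of dowling by <:].

(* P <= Q when the graph of every block of Q is a union of graphs of blocks
   of P: each block of Q is obtained by gluing translates of blocks of P, the
   remaining blocks of P being absorbed into the zero block. *)
Definition dowling_le (P Q : dowling) : bool :=
  [forall B in gblocks Q, B == cover (gblocks P ::&: B)].

Lemma dowling_leP (P Q : dowling) :
  reflect (forall B x, B \in gblocks Q -> x \in B ->
             exists2 A, A \in gblocks P & (x \in A) && (A \subset B))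
          (dowling_le P Q).
Proof.
apply: (iffP forall_inP) => [le_PQ B x QB xB | le_PQ B QB].
  move: (xB); rewrite {1}(eqP (le_PQ B QB)) => /bigcupP[A].
  by rewrite inE => /andP[PA sAB] xA; exists A; rewrite // xA.
rewrite eqEsubset; apply/andP; split; apply/subsetP => x.
  move=> xB; have [A PA /andP[xA sAB]] := le_PQ B x QB xB.
  by apply/bigcupP; exists A; rewrite // inE PA.
by case/bigcupP=> A; rewrite inE => /andP[_ /subsetP]; apply.
Qed.

Lemma dowling_le_refl : reflexive dowling_le.
Proof. by move=> P; apply/dowling_leP => B x PB xB; exists B; rewrite ?xB /=. Qed.

Lemma dowling_le_sub (P Q : dowling) :
  dowling_le P Q -> dowling_le Q P -> gblocks Q \subset gblocks P.
Proof.
move=> /dowling_leP le_PQ /dowling_leP le_QP; apply/subsetP => B QB.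
have /and4P[/trivIsetP tQ Q0 _ _] : is_partial_gpartition Q by case: (Q).
have [B0|[x xB]] := set_0Vmem B; first by rewrite B0 (negPf Q0) in QB.
have [A PA /andP[xA sAB]] := le_PQ B x QB xB.
have [B' QB' /andP[xB' sB'A]] := le_QP A x PA xA.
have eqB : B' = B.
  apply/eqP; apply: contraT => neqB; have := tQ _ _ QB' QB neqB.
  by rewrite disjoint_subset => /subsetP/(_ x xB'); rewrite inE xB.
suff -> : B = A by [].
by apply/eqP; rewrite eqEsubset sAB -{1}eqB sB'A.
Qed.

Lemma dowling_le_anti : antisymmetric dowling_le.
Proof.
move=> P Q /andP[le_PQ le_QP]; apply/val_inj/eqP.
by rewrite eqEsubset /= !dowling_le_sub.
Qed.

Lemma dowling_le_trans : transitive dowling_le.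
Proof.
move=> Q P S /dowling_leP le_PQ /dowling_leP le_QS.
apply/dowling_leP => C x SC xC.
have [B QB /andP[xB sBC]] := le_QS C x SC xC.
have [A PA /andP[xA sAB]] := le_PQ B x QB xB.
by exists A; rewrite // xA (subset_trans sAB).
Qed.

Fact dowling_display : Order.disp_t. Proof. exact: (Order.Disp tt tt). Qed.

HB.instance Definition _ := Order.Le_isPOrder.Build dowling_display dowling
  dowling_le_refl dowling_le_anti dowling_le_trans.

End Dowling.

Definition whitney_dowling (gT : finGroupType) (n k : nat) : nat :=
  whitney2 (dowling n gT) k.

Local Open Scope ring_scope.

Definition qge (R : realType) (f g : {poly R}) : Prop :=
  forall i : nat, 0 <= (f - g)`_i.

Definition strongly_q_log_convex (R : realType) (f : nat -> {poly R}) : Prop :=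
  forall n l : nat, (1 <= l)%N -> (l <= n)%N ->
    qge (f l.-1 * f n.+1) (f l * f n).

Definition dowling_poly (R : realType) (gT : finGroupType) (n : nat) : {poly R} :=
  \sum_(k < n.+1) (whitney_dowling gT n k)%:R *: 'X^k.

Definition dowling_F1 (R : realType) (gT : finGroupType) (m n : nat) : {poly R} :=
  \sum_(k < n.+1) (k`! * whitney_dowling gT n k * m ^ k)%:R *: 'X^k.

Definition dowling_F2 (R : realType) (gT : finGroupType) (n : nat) : {poly R} :=
  \sum_(k < n.+1) (k`! * whitney_dowling gT n k)%:R *: 'X^k.

(* Main.v *)
(** Points of a partial G-partition P of an n-set can be made isolated one at a
time, each step adding one block, so P has rank n - #|P| / #|G| and the Whitney numbers count
partial G-partitions by their number of blocks.  Removing one point i gives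
Dowling's recurrence: i lies in the zero block, or is a block by itself, or is
glued to one of the m k labelled blocks of the rest.

Each of the three polynomial sequences has coefficients with
T(n+1,k) = (a0 + a1 k) T(n,k) + (b0 + b1 k) T(n,k-1), all weights being
nonnegative.  In terms of polynomials, f_{n+1} = p f_n + r f_n' with
r = a1 q + b1 q^2, hence f_j f_{n+1} - f_{j+1} f_n = r (f_j f_n' - f_j' f_n).
The coefficients of this Wronskian are nonnegative combinations of the 2x2
minors of the rows j and n of T, and these minors are nonnegative because T is
obtained row by row by multiplication with a nonnegative bidiagonal matrix. *)
Require Import Defs.
From mathcomp Require Import all_boot all_order all_fingroup all_algebra.
From mathcomp Require Import reals ring zify.

Set Implicit Arguments.
Unset Strict Implicit.
Unset Printing Implicit Defensive.

Import Order.TTheory GRing.Theory Num.Theory.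

(** * Nonnegative 2x2 minors of triangular arrays, and Wronskians *)

Section TriangularArrays.
Local Open Scope ring_scope.
Variable R : realType.
Implicit Types u v : nat -> R.

(** All 2x2 minors of the two-row matrix with rows [u] and [v] are nonnegative. *)
Definition minor_dominated u v :=
  forall i k, (i <= k)%N -> 0 <= u i * v k - u k * v i.

Definition prev u k := if k is k'.+1 then u k' else 0.

(** By Cauchy-Binet, a new minor is a combination of four old ones whose coefficients are products
    of the weights. *)
Lemma minor_dominated_step (a b : nat -> R) u v :
    (forall k, 0 <= a k) -> (forall k, 0 <= b k) -> minor_dominated u v ->
  minor_dominated (fun k => a k * u k + b k * prev u k)
                  (fun k => a k * v k + b k * prev v k).
Proof.
(* For [i = k] the minor is zero. For [i < k] one has [i <= k - 1], so the columns of all four old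
   minors are still in order. *)
move=> a_ge0 b_ge0 uv i k; rewrite leq_eqVlt => /predU1P[->|lt_ik].
  by rewrite mulrC subrr.
have expand (ai ak bi bk ui uk vi vk xi xk yi yk : R) :
  (ai * ui + bi * xi) * (ak * vk + bk * yk)
    - (ak * uk + bk * xk) * (ai * vi + bi * yi)
  = ai * ak * (ui * vk - uk * vi) + ai * bk * (ui * yk - xk * vi)
    + (bi * ak * (xi * vk - uk * yi) + bi * bk * (xi * yk - xk * yi)).
  by ring.
rewrite expand; case: k lt_ik => // k; rewrite ltnS => le_ik /=.
have nonneg := (mulr_ge0, a_ge0, b_ge0, uv).
rewrite !addr_ge0 //; try by rewrite !nonneg // leqW.
  case: i le_ik => [|i] /= le_ik; first by rewrite mul0r mulr0 subrr mulr0.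
  by rewrite !nonneg // ltnW // leqW.
case: i le_ik => [|i] /= le_ik; first by rewrite mul0r mulr0 subrr mulr0.
by rewrite !nonneg // ltnW.
Qed.

Lemma coefXderiv (r : {poly R}) j : ('X * r^`())`_j = r`_j * j%:R.
Proof. by rewrite coefXM; case: j => [|j] /=; rewrite ?mulr0 // coef_deriv mulr_natr. Qed.

(** Twice the coefficient is the sum over [j] of the minor of columns [j] and [i - j] times
    [(i - j) - j], and these two factors never have opposite signs. The factor ['X] makes
    differentiation act on coefficients as multiplication by the index. *)
Lemma coef_wronskian_ge0 (p q : {poly R}) i :
    minor_dominated (nth 0 p) (nth 0 q) ->
  0 <= ('X * (p * q^`() - p^`() * q))`_i.
Proof.
move=> pq; rewrite mulrBr [X in X - _]mulrCA [X in _ - X]mulrA.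
set s := _`_i.
have s_eq : s = \sum_(j < i.+1) (p`_j * q`_(i - j)) * ((i - j)%:R - j%:R).
  rewrite /s coefB !coefM -sumrB; apply: eq_bigr => j _.
  by rewrite !coefXderiv mulrA [X in _ - X]mulrAC mulrBr.
have s_rev : s = \sum_(j < i.+1) (p`_(i - j) * q`_j) * (j%:R - (i - j)%:R).
  rewrite s_eq (reindex_inj rev_ord_inj); apply: eq_bigr => j _ /=.
  by rewrite subSS subKn // -ltnS.
(* Averaging with the reversed sum pairs the terms j and i - j. *)
have -> : s = 2^-1 * (s + s) by field.
rewrite {1}s_eq s_rev -big_split /= mulr_ge0 ?invr_ge0 ?ler0n //.
apply: sumr_ge0 => j _.
have -> (x y z t : R) : x * (z - t) + y * (t - z) = (x - y) * (z - t) by ring.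
have [le_j|lt_j] := leqP j (i - j).
  by rewrite mulr_ge0 ?subr_ge0 ?ler_nat // -subr_ge0 pq.
rewrite mulr_le0 //; last by rewrite subr_le0 ler_nat ltnW.
by rewrite -oppr_ge0 opprB mulrC [X in _ - X]mulrC [X in X - _]mulrC
           [X in _ - X]mulrC pq // ltnW.
Qed.

Variables (a0 a1 b0 b1 : R).
Hypotheses (a0_ge0 : 0 <= a0) (a1_ge0 : 0 <= a1).
Hypotheses (b0_ge0 : 0 <= b0) (b1_ge0 : 0 <= b1).
Variable f : nat -> {poly R}.
Hypothesis f0 : f 0 = 1.
Hypothesis coef_fS : forall n k, (f n.+1)`_k =
  (a0 + a1 * k%:R) * (f n)`_k + (b0 + b1 * k%:R) * prev (nth 0 (f n)) k.

(** Induction strips one application of the recurrence from both rows until the upper row is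
    [f 0 = 1]. There a minor is zero or a single entry of the lower row. *)
Lemma triangular_minors j n :
  (j <= n)%N -> minor_dominated (nth 0 (f j)) (nth 0 (f n)).
Proof.
elim: j n => [|j IHj] [|n] // le_jn i k le_ik.
- by rewrite mulrC subrr.
- rewrite f0 !coef1; case: k le_ik => [|k] le_ik.
    by rewrite leqn0 in le_ik; rewrite (eqP le_ik) subrr.
  rewrite mul0r subr0 mulr_ge0 ?ler0n //.
  (* The entries are nonnegative, by induction on the row. *)
  elim: n.+1 k.+1 => [|d IHd] h; first by rewrite f0 coef1 ler0n.
  rewrite coef_fS addr_ge0 ?mulr_ge0 ?addr_ge0 ?mulr_ge0 ?ler0n //.
  by case: h.
- rewrite !coef_fS.
  apply: (minor_dominated_step (a := fun k => a0 + a1 * k%:R)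
                               (b := fun k => b0 + b1 * k%:R)) => //.
  + by move=> h; rewrite addr_ge0 ?mulr_ge0 ?ler0n.
  + by move=> h; rewrite addr_ge0 ?mulr_ge0 ?ler0n.
  + exact: IHj.
Qed.

(** Multiplying the coefficient of index [k] by [k] is the operator ['X] times derivative. In the
    shifted term [b0 + b1 k = (b0 + b1) + b1 (k - 1)], whence the constant [b0 + b1]. *)
Lemma triangular_derivE n :
  f n.+1 = (a0%:P + (b0 + b1) *: 'X) * f n
           + (a1%:P + b1 *: 'X) * ('X * (f n)^`()).
Proof.
apply/polyP => k.
rewrite coef_fS !mulrDl !coefD -!scalerAl !mul_polyC !coefZ.
rewrite [('X * f n)`_k]coefXM [('X * ('X * _))`_k]coefXM !coefXderiv.
case: k => [|k] /=; first by ring.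
by rewrite -natr1; move: k%:R => x; ring.
Qed.

Lemma triangular_strongly_q_log_convex : strongly_q_log_convex f.
Proof.
move=> n [|l] // _ lt_ln i; rewrite /= !triangular_derivE.
set L := a0%:P + _; set B := a1%:P + _.
(* The multiplier [L] cancels; what is left is a Wronskian times [B], which has nonnegative
   coefficients. *)
have -> : f l * (L * f n + B * ('X * (f n)^`()))
          - (L * f l + B * ('X * (f l)^`())) * f n
          = B * ('X * (f l * (f n)^`() - (f l)^`() * f n)) by ring.
have wr k := @coef_wronskian_ge0 _ _ k (triangular_minors (ltnW lt_ln)).
rewrite mulrDl coefD mul_polyC -scalerAl !coefZ.
by rewrite addr_ge0 ?mulr_ge0 ?wr // coefXM; case: i => [|i] //=; apply: wr.
Qed.

End TriangularArrays.

(** * Recognising the rank function of a finite poset *)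

Lemma poset_rank_at_eq (d : Order.disp_t) (T : finPOrderType d) (rho : T -> nat) :
    (forall x y, (x < y)%O -> rho x < rho y) ->
    (forall x, 0 < rho x -> exists2 y, (y < x)%O & rho x = (rho y).+1) ->
  forall x, poset_rank_at x = rho x.
Proof.
move=> rho_mono rho_pred x; apply/eqP; rewrite eqn_leq; apply/andP; split.
  (* Upper bound: [rho] is injective on a chain and takes values below [rho x] on it. The type
     ['I_(rho x).-1.+1] is nonempty by form, as [inord] requires, and has [rho x] elements once the
     chain is nonempty. *)
  apply/bigmax_leqP => C /andP[/forall_inP chainC /forall_inP below].
  have injC : {in C &, injective (fun y => inord (rho y) : 'I_(rho x).-1.+1)}.
    move=> y z yC zC /(congr1 val) /=.
    have yx := rho_mono _ _ (below _ yC); have zx := rho_mono _ _ (below _ zC).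
    rewrite !inordK ?(ltn_predK yx) // => eq_rho.
    have /forall_inP/(_ z zC) := chainC _ yC.
    by case: comparableP => // /rho_mono; rewrite eq_rho ltnn.
  have [->|/set0Pn[y yC]] := eqVneq C set0; first by rewrite cards0.
  rewrite -(card_in_imset injC) (leq_trans (max_card _)) // card_ord.
  by rewrite (ltn_predK (rho_mono _ _ (below _ yC))).
(* Lower bound: descending from [x] through elements where [rho] drops by one gives a chain of
   [rho x] elements. *)
suff [C chainC cardC] : exists2 C : {set T},
    [forall y in C, forall z in C, (y >=< z)%O] && [forall y in C, (y < x)%O]
    & #|C| = rho x.
  by rewrite -cardC /poset_rank_at; apply: (leq_bigmax_cond C).
elim: {x}(rho x) {-2}x (erefl (rho x)) => [|k IHk] x rho_x.
  by exists set0; rewrite ?cards0 //; apply/andP; split; apply/forall_inP => y;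
     rewrite inE.
have [|y yx] := rho_pred x; first by rewrite rho_x.
rewrite rho_x => -[eq_k].
have [C /andP[/forall_inP chainC /forall_inP below] cardC] := IHk y (esym eq_k).
have yNC : y \notin C by apply: (contraFN (below y) (ltxx y)).
exists (y |: C); last by rewrite cardsU1 yNC cardC add1n eq_k.
apply/andP; split; apply/forall_inP => z /setU1P[->|zC] //.
- apply/forall_inP => t /setU1P[->|tC]; first exact: comparablexx.
  by rewrite comparable_sym lt_comparable ?below.
- apply/forall_inP => t /setU1P[->|tC]; first by rewrite lt_comparable ?below.
  by have /forall_inP-> := chainC z zC.
- by rewrite (lt_trans (below z zC)).
Qed.

(** * Partial G-partitions and the translation action *)

Section PartialGPartitions.
Variables (n : nat) (gT : finGroupType).
Local Open Scope group_scope.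
Implicit Types (P Q : {set {set 'I_n * gT}}) (B C : {set 'I_n * gT}).
Implicit Types (x y : 'I_n * gT) (g h : gT) (i : 'I_n) (A : {set 'I_n}).

Lemma mem_translate g B x : (x \in translate g B) = ((x.1, g^-1 * x.2) \in B).
Proof.
apply/imsetP/idP => [[y yB ->] | xB] /=; first by rewrite mulKg -surjective_pairing.
by exists (x.1, g^-1 * x.2) => //=; rewrite mulKVg -surjective_pairing.
Qed.

Lemma translateM g h B : translate g (translate h B) = translate (g * h) B.
Proof. by apply/setP => x; rewrite !mem_translate invMg mulgA. Qed.

Lemma translate1 B : translate 1 B = B.
Proof.
by apply/setP => x; rewrite mem_translate invg1 mul1g -surjective_pairing.
Qed.

Lemma translateK g : cancel (@translate n gT g) (translate g^-1).
Proof. by move=> B; rewrite translateM mulVg translate1. Qed.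

Lemma translateKV g : cancel (translate g^-1) (@translate n gT g).
Proof. by move=> B; rewrite translateM mulgV translate1. Qed.

Lemma translate_eq0 g B : (translate g B == set0) = (B == set0).
Proof. by rewrite imset_eq0. Qed.

Lemma gpartitionP P : reflect
  [/\ forall B C x, B \in P -> C \in P -> x \in B -> x \in C -> B = C,
      set0 \notin P,
      forall g B, B \in P -> translate g B \in P
    & forall B x y, B \in P -> x \in B -> y \in B -> x.1 = y.1 -> x = y]
  (is_partial_gpartition P).
Proof.
apply: (iffP and4P) => -[].
  move=> /trivIsetP tP P0 /forallP trP /forall_inP funP; split=> //.
  - move=> B C x PB PC xB xC; apply/eqP; apply: contraT => neqB.
    by have := disjointFr (tP _ _ PB PC neqB) xB; rewrite xC.
  - by move=> g B; have /forall_inP := trP g; apply.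
  - move=> B x y /funP/forall_inP/[apply]/forall_inP/[apply]/implyP eqxy exy.
    by apply/eqP/eqxy/eqP.
move=> tP P0 trP funP; split=> //.
- apply/trivIsetP => B C PB PC; apply: contraR => /pred0Pn[x /andP[/= xB xC]].
  exact/eqP/(tP _ _ x).
- by apply/forallP => g; apply/forall_inP => B; apply: trP.
- apply/forall_inP => B PB; apply/forall_inP => x xB; apply/forall_inP => y yB.
  by apply/implyP => /eqP exy; apply/eqP/(funP B).
Qed.

(** The action on blocks is free: a common translate puts [(i, a)] and [(i, h^-1 g a)] in the same
    block, which is the graph of a function. *)
Lemma translate_inj P B g h : is_partial_gpartition P -> B \in P ->
  translate g B = translate h B -> g = h.
Proof.
case/gpartitionP => _ P0 trP funP PB eq_gh.
have [B0|[x xB]] := set_0Vmem B; first by rewrite B0 (negPf P0) in PB.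
have xgB : (x.1, g * x.2) \in translate g B.
  by rewrite mem_translate /= mulKg -surjective_pairing.
have := xgB; rewrite eq_gh mem_translate /= => xhB.
have /(congr1 snd)/= := funP B _ _ PB xhB xB erefl.
by move/(canRL (mulKVg h))/mulIg.
Qed.

(** [P] splits into orbits under translation, each of size [#|gT|] because the action is free. *)
Lemma gpartition_card P : is_partial_gpartition P ->
  exists k, #|P| = (k * #|gT|)%N.
Proof.
move=> gpP; have /gpartitionP[tP P0 trP funP] := gpP.
pose class B := [set translate g B | g : gT].
exists #|class @: P|; rewrite -sum1_card (partition_big_imset class) /=.
rewrite -sum_nat_const; apply: eq_bigr => _ /imsetP[B PB ->].
transitivity #|class B|; last first.
  by rewrite card_imset // => g h; apply: translate_inj gpP PB.
rewrite sum1dep_card.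
apply: eq_card => C; rewrite !inE; apply/andP/imsetP => [[PC /eqP eqC]|[g _ ->]].
  have: C \in class B by rewrite -eqC; apply/imsetP; exists 1; rewrite ?translate1.
  by case/imsetP => g _ ->; exists g; rewrite ?inE.
split; first exact: trP.
apply/eqP/setP => D; apply/imsetP/imsetP => -[h _ ->].
  by exists (h * g); rewrite // translateM.
by exists (h * g^-1); rewrite // translateM mulgKV.
Qed.

(** Every block of [Q] meets a block of [P]; the latter is also a block of [Q], so disjointness
    makes them equal. *)
Lemma gpartition_cover_eq P Q : is_partial_gpartition P ->
  is_partial_gpartition Q -> P \subset Q -> cover Q \subset cover P -> P = Q.
Proof.
move=> /gpartitionP[tP P0 _ _] /gpartitionP[tQ Q0 _ _] sPQ sQP.
apply/eqP; rewrite eqEsubset sPQ; apply/subsetP => B QB.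
have [B0|[x xB]] := set_0Vmem B; first by rewrite B0 (negPf Q0) in QB.
have /(subsetP sQP)/bigcupP[C PC xC] : x \in cover Q by apply/bigcupP; exists B.
by rewrite (tQ B C x) // (subsetP sPQ).
Qed.

(** * Deleting a point *)

Definition fiber i : {set 'I_n * gT} := [set x | x.1 == i].
Definition singletons i : {set {set 'I_n * gT}} := [set [set (i, g)] | g : gT].
(** A block lying over [i] alone becomes empty and has to be dropped. *)
Definition delete i P := [set B :\: fiber i | B in P] :\ set0.

Lemma deleteP i P B : reflect
  (B != set0 /\ exists2 C, C \in P & B = C :\: fiber i) (B \in delete i P).
Proof.
by rewrite !inE; apply: (iffP andP) => -[B0 /imsetP]; split.
Qed.

Lemma delete_gpartition i P :
  is_partial_gpartition P -> is_partial_gpartition (delete i P).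
Proof.
move=> /gpartitionP[tP P0 trP funP]; apply/gpartitionP; split.
- move=> _ _ x /deleteP[_ [B PB ->]] /deleteP[_ [C PC ->]].
  by move=> /setDP[xB _] /setDP[xC _]; rewrite (tP B C x).
- by rewrite !inE eqxx.
- move=> g D /deleteP[D0 [B PB eqD]]; apply/deleteP; split.
    by rewrite translate_eq0.
  exists (translate g B); first exact: trP.
  by rewrite eqD; apply/setP => x; rewrite !(inE, mem_translate).
- move=> _ x y /deleteP[_ [B PB ->]] /setDP[xB _] /setDP[yB _].
  exact: (funP B).
Qed.

Lemma cover_delete i P : cover (delete i P) = cover P :\: fiber i.
Proof.
apply/setP => x; apply/bigcupP/setDP => [[_ /deleteP[_ [B PB ->]]]|].
  by case/setDP => xB xi; split=> //; apply/bigcupP; exists B.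
case=> /bigcupP[B PB xB] xi; exists (B :\: fiber i); last by rewrite inE xi.
by apply/deleteP; split; [apply/set0Pn; exists x; rewrite inE xi | exists B].
Qed.

Lemma delete_id i P : is_partial_gpartition P ->
  [disjoint cover P & fiber i] -> delete i P = P.
Proof.
move=> /gpartitionP[_ P0 _ _] /pred0P dis.
have eqB B : B \in P -> B :\: fiber i = B.
  move=> PB; apply/setP => x; rewrite in_setD; case xB: (x \in B); rewrite ?andbF //.
  have := dis x; rewrite /= (_ : x \in cover P) /= => [->//|].
  by apply/bigcupP; exists B.
apply/setP => B; apply/deleteP/idP => [[_ [C PC ->]]|PB]; first by rewrite eqB.
split; first by apply: contraNneq P0 => <-.
by exists B; rewrite ?eqB.
Qed.

(** A block over [i] alone is a single point, which a translation moves to [(i, 1)]. Membership of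
    [[set (i, 1)]] is therefore the test for [i] being isolated. *)
Lemma subset_fiber P B i : is_partial_gpartition P -> B \in P ->
  B \subset fiber i -> [set (i, 1)] \in P.
Proof.
move=> /gpartitionP[_ P0 trP funP] PB /subsetP sBi.
have [B0|[x xB]] := set_0Vmem B; first by rewrite B0 (negPf P0) in PB.
have := sBi x xB; rewrite inE => /eqP xi.
suff <- : translate x.2^-1 B = [set (i, 1)] by apply: trP.
apply/setP => -[j g]; rewrite mem_translate invgK inE /=.
apply/idP/eqP => [jB | [-> ->]]; last by rewrite mulg1 -xi -surjective_pairing.
have := sBi _ jB; rewrite inE /= => /eqP eqj.
have /(congr1 snd)/= := funP B _ _ PB jB xB (etrans eqj (esym xi)).
by rewrite eqj => /(canRL (mulKg _)) ->; rewrite mulVg.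
Qed.

Section NoSingleton.
Variables (P : {set {set 'I_n * gT}}) (i : 'I_n).
Hypotheses (gpP : is_partial_gpartition P) (noi : [set (i, 1)] \notin P).

Lemma setD_fiber_neq0 B : B \in P -> B :\: fiber i != set0.
Proof.
by move=> PB; rewrite setD_eq0; apply: contra noi; apply: subset_fiber.
Qed.

Lemma setD_fiber_inj : {in P &, injective (fun B => B :\: fiber i)}.
Proof.
have /gpartitionP[tP _ _ _] := gpP.
move=> B C PB PC eqBC; have /set0Pn[x xB] := setD_fiber_neq0 PB.
have := xB; rewrite eqBC => /setDP[xC _]; case/setDP: xB => xB _.
exact: tP PB PC xB xC.
Qed.

(** No block becomes empty, and nonempty remainders of disjoint blocks stay distinct. *)
Lemma card_delete : #|delete i P| = #|P|.
Proof.
rewrite -(card_in_imset setD_fiber_inj) /delete (cardsD1 set0 (_ @: _)).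
suff /negPf-> : set0 \notin [set B :\: fiber i | B in P] by [].
apply/negP => /imsetP[B PB /esym/eqP].
by rewrite (negPf (setD_fiber_neq0 PB)).
Qed.

End NoSingleton.

(** * Adding an isolated point *)

Lemma singletonsP i B : reflect (exists g, B = [set (i, g)]) (B \in singletons i).
Proof.
by apply: (iffP imsetP) => [[g _ ->]|[g ->]]; exists g.
Qed.

Lemma card_singletons i : #|singletons i| = #|gT|.
Proof.
by rewrite card_imset ?cardsT // => g h /set1_inj[].
Qed.

Lemma translate_set1 g i h : translate g [set (i, h)] = [set (i, g * h)].
Proof. by rewrite /translate imset_set1. Qed.

Lemma singletons_subset P i : is_partial_gpartition P ->
  [set (i, 1)] \in P -> singletons i \subset P.
Proof.
move=> /gpartitionP[_ _ trP _] Pi; apply/subsetP => _ /singletonsP[g ->].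
by rewrite -[g]mulg1 -translate_set1 trP.
Qed.

Lemma cover_singletons i : cover (singletons i) = fiber i.
Proof.
apply/setP => -[j g]; rewrite inE; apply/bigcupP/eqP => /= [[_ /singletonsP[h ->]]|->].
  by rewrite inE => /eqP[].
by exists [set (i, g)]; [apply/singletonsP; exists g | rewrite inE].
Qed.

Section AddSingletons.
Variables (Q : {set {set 'I_n * gT}}) (i : 'I_n).
Hypotheses (gpQ : is_partial_gpartition Q).
Hypothesis Qi : [disjoint cover Q & fiber i].

Lemma notin_fiber B x : B \in Q -> x \in B -> x.1 != i.
Proof.
move=> QB xB; have := disjointFr Qi (_ : x \in cover Q); rewrite inE => -> //.
by apply/bigcupP; exists B.
Qed.

Lemma add_singletons_gpartition : is_partial_gpartition (Q :|: singletons i).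
Proof.
have /gpartitionP[tQ Q0 trQ funQ] := gpQ; apply/gpartitionP; split.
- move=> B C x /setUP[QB|/singletonsP[g ->]] /setUP[QC|/singletonsP[h ->]].
  + exact: tQ.
  + by move=> xB /set1P eqx; have := notin_fiber QB xB; rewrite eqx eqxx.
  + by move=> /set1P eqx xC; have := notin_fiber QC xC; rewrite eqx eqxx.
  + by move=> /set1P-> /set1P[->].
- rewrite in_setU negb_or Q0; apply/singletonsP => -[g /setP/(_ (i, g))].
  by rewrite !inE eqxx.
- move=> g B /setUP[QB|/singletonsP[h ->]]; first by rewrite in_setU trQ.
  by rewrite translate_set1 inE; apply/orP; right; apply/singletonsP; exists (g * h).
- move=> B x y /setUP[QB|/singletonsP[h ->]]; first exact: funQ.
  by move=> /set1P-> /set1P->.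
Qed.

Lemma disjoint_singletons : [disjoint Q & singletons i].
Proof.
apply/pred0Pn => -[B /andP[/= QB /singletonsP[g eqB]]].
by have := notin_fiber (x := (i, g)) QB; rewrite eqB inE eqxx => /(_ isT) /eqP.
Qed.

Lemma card_add_singletons : #|Q :|: singletons i| = (#|Q| + #|gT|)%N.
Proof.
by rewrite cardsU (_ : Q :&: _ = set0) ?cards0 ?subn0 ?card_singletons //;
   apply/eqP; rewrite setI_eq0 disjoint_singletons.
Qed.

End AddSingletons.

Lemma delete_disjoint i P : [disjoint cover (delete i P) & fiber i].
Proof.
by rewrite cover_delete disjoint_subset; apply/subsetP => x /setDP[].
Qed.

(** * The rank function of the Dowling lattice *)

Lemma card_gpartition_le P : is_partial_gpartition P -> #|P| <= n * #|gT|.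
Proof.
move=> /and4P[tP P0 _ _].
have <- : #|[set: 'I_n * gT]| = (n * #|gT|)%N by rewrite cardsT card_prod card_ord.
apply: leq_trans (subset_leq_card (subsetT (cover P))).
rewrite -(eqP tP) -sum1_card; apply: leq_sum => B PB.
by rewrite card_gt0; apply: contraNneq P0 => <-.
Qed.

Lemma dowlingP (P : dowling n gT) : is_partial_gpartition P.
Proof. by case: P. Qed.

Lemma dowling_lt_card (P Q : dowling n gT) : (P < Q)%O -> #|Q| < #|P|.
Proof.
rewrite lt_neqAle => /andP[neqPQ /dowling_leP le_PQ].
have /gpartitionP[tP P0 _ _] := dowlingP P.
have /gpartitionP[tQ Q0 _ _] := dowlingP Q.
(* Each block of Q contains a block of P, chosen injectively. *)
pose part B := odflt set0 [pick A : {set 'I_n * gT} in gblocks P | A \subset B].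
have partP B : B \in gblocks Q -> part B \in gblocks P /\ part B \subset B.
  move=> QB; rewrite /part; case: pickP => [A /andP[] //|noA].
  have [B0|[x xB]] := set_0Vmem B; first by rewrite B0 (negPf Q0) in QB.
  have [A PA /andP[_ sAB]] := le_PQ B x QB xB.
  by have := noA A; rewrite /= PA sAB.
have part_inj : {in gblocks Q &, injective part}.
  move=> B C QB QC eqBC; have [PB sB] := partP B QB; have [_ sC] := partP C QC.
  have [B0|[y yB]] := set_0Vmem (part B); first by rewrite B0 (negPf P0) in PB.
  by apply: (tQ B C y) => //; [apply: (subsetP sB)|apply: (subsetP sC); rewrite -eqBC].
have part_sub : part @: gblocks Q \subset gblocks P.
  by apply/subsetP => _ /imsetP[B /partP[PB _] ->].
rewrite ltnNge -(card_in_imset part_inj); apply: contra neqPQ => le_card.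
(* If [P] had at most as many blocks as [Q], the choice [part] would be onto [P]. *)
have /eqP eq_part : part @: gblocks Q == gblocks P by rewrite eqEcard part_sub.
apply/eqP/val_inj/esym/eqP; rewrite eqEcard /= -(card_in_imset part_inj) le_card andbT.
apply/subsetP => B QB; have [PB sB] := partP B QB.
(* A block of [P] inside [B] is chosen for some [C] meeting [B], so [C = B]: the chosen block is the
   only one inside [B] and fills it. *)
suff <- : part B = B by [].
apply/eqP; rewrite eqEsubset sB; apply/subsetP => x xB.
have [A PA /andP[xA sAB]] := le_PQ B x QB xB.
have := PA; rewrite -eq_part => /imsetP[C QC eqA].
have [_ sC] := partP C QC.
suff -> : B = C by rewrite -eqA.
by apply: (tQ B C x) => //; apply: (subsetP sC); rewrite -eqA.
Qed.

Lemma cardG_gt0 : 0 < #|gT|.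
Proof. by apply/card_gt0P; exists 1. Qed.

Lemma gpartition_blocks P : is_partial_gpartition P ->
  #|P| = (#|P| %/ #|gT| * #|gT|)%N.
Proof. by case/gpartition_card => k ->; rewrite mulnK ?cardG_gt0. Qed.

Lemma isolate_gpartition P i : is_partial_gpartition P ->
  is_partial_gpartition (delete i P :|: singletons i).
Proof.
by move=> gpP; apply/add_singletons_gpartition/delete_disjoint/delete_gpartition.
Qed.

(** Cutting [i] out of its blocks and making it a block by itself goes down in the order: each old
    block is the union of its part off [i] and its points over [i]. *)
Lemma isolate_dowling (P : dowling n gT) i : [set (i, 1)] \notin gblocks P ->
  exists2 Q : dowling n gT, (Q < P)%O & #|Q| = (#|P| + #|gT|)%N.
Proof.
move=> noi; have gpP := dowlingP P.
have /gpartitionP[tP P0 trP funP] := gpP.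
pose Q := Dowling (isolate_gpartition i gpP).
have cardQ : #|Q| = (#|P| + #|gT|)%N.
  by rewrite card_add_singletons ?delete_disjoint // card_delete.
exists Q => //; rewrite lt_neqAle; apply/andP; split.
  by apply/eqP => eqQP; have := cardG_gt0; move: cardQ; rewrite eqQP; lia.
apply/dowling_leP => B x PB xB; have [xi|xi] := boolP (x \in fiber i).
  exists [set x]; last by rewrite set11 sub1set.
  rewrite inE; apply/orP; right; apply/singletonsP; exists x.2.
  by move: xi; rewrite inE => /eqP <-; rewrite -surjective_pairing.
exists (B :\: fiber i); last by rewrite in_setD xi xB subsetDl.
rewrite inE; apply/orP; left; apply/deleteP; split; last by exists B.
by apply/set0Pn; exists x; rewrite in_setD xi.
Qed.

Lemma dowling_rank_at (P : dowling n gT) :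
  poset_rank_at P = (n - #|P| %/ #|gT|)%N.
Proof.
have G0 := cardG_gt0.
have blocks_le (Q : dowling n gT) : #|Q| %/ #|gT| <= n.
  by rewrite -[leqRHS](mulnK n G0) leq_div2r // card_gpartition_le // dowlingP.
apply: (poset_rank_at_eq (rho := fun P : dowling n gT => n - #|P| %/ #|gT|)%N).
  move=> {}P Q /dowling_lt_card lt_card.
  have := blocks_le P; suff : #|Q| %/ #|gT| < #|P| %/ #|gT| by lia.
  by rewrite ltn_divLR // -gpartition_blocks ?dowlingP.
move=> {}P; rewrite subn_gt0 => lt_n.
(* If every index were isolated, [P] would contain all [n * #|gT|] singletons, which contradicts
   positive rank. *)
have /existsP[i noi] : [exists i : 'I_n, [set (i, 1)] \notin gblocks P].
  apply: contraLR lt_n; rewrite negb_exists -leqNgt => /forallP all1.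
  rewrite leq_divRL //.
  have <- : #|[set: 'I_n * gT]| = (n * #|gT|)%N by rewrite cardsT card_prod card_ord.
  rewrite -(card_imset _ set1_inj) subset_leq_card //.
  apply/subsetP => _ /imsetP[[i g] _ ->].
  have /subsetP := singletons_subset (dowlingP P) (negbNE (all1 i)).
  by apply; apply/singletonsP; exists g.
have [Q ltQP cardQ] := isolate_dowling noi; exists Q => //.
have := blocks_le Q.
by rewrite cardQ divnDr // divnn G0; lia.
Qed.

Lemma set0_gpartition : is_partial_gpartition (set0 : {set {set 'I_n * gT}}).
Proof.
by apply/gpartitionP; split=> [B C x||g B|B x y]; rewrite ?inE.
Qed.

(** The maximum is attained at the empty partition, where all indices lie in the zero block. *)
Lemma dowling_rank : poset_rank (dowling n gT) = n.
Proof.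
apply/eqP; rewrite eqn_leq; apply/andP; split.
  by apply/bigmax_leqP => P _; rewrite dowling_rank_at leq_subr.
rewrite /poset_rank.
have := leq_bigmax (F := @poset_rank_at _ (dowling n gT)) (Dowling set0_gpartition).
by rewrite dowling_rank_at /= cards0 div0n subn0.
Qed.

(** * Whitney numbers as counts of partial G-partitions *)

Definition over A : {set 'I_n * gT} := [set x | x.1 \in A].

(** Restricting the support to [A] lets the recurrence remove a point without changing the ambient
    type ['I_n]. *)
Definition gpartitions_over A k : {set {set {set 'I_n * gT}}} :=
  [set P | [&& is_partial_gpartition P, cover P \subset over A
             & #|P| == k * #|gT|]]%N.

Lemma whitney_dowlingE k : whitney_dowling gT n k = #|gpartitions_over setT k|.
Proof.
rewrite /whitney_dowling /whitney2 dowling_rank.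
rewrite -(card_imset _ val_inj); apply: eq_card => P; rewrite inE.
have G0 := cardG_gt0.
(* Corank [k] means [k] blocks; the truncated subtraction is exact since there are at most [n]
   blocks. *)
have key (Q : {set {set 'I_n * gT}}) : is_partial_gpartition Q ->
    (n - #|Q| %/ #|gT| + k == n)%N = (#|Q| == k * #|gT|)%N.
  move=> gpQ; have le_n : #|Q| %/ #|gT| <= n 
    by rewrite -[leqRHS](mulnK n G0) leq_div2r // card_gpartition_le.
  rewrite {2}gpartition_blocks // eqn_pmul2r //; lia.
apply/imsetP/and3P => [[Q]|[gpP _ cardP]].
  rewrite inE dowling_rank_at => rkQ -> /=; split; first exact: dowlingP.
    by apply/subsetP => x _; rewrite !inE.
  by rewrite -key // dowlingP.
by exists (Dowling gpP); rewrite // inE dowling_rank_at /= key.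
Qed.

(** * Gluing a point to an existing block *)

Section Attach.
Variables (Q : {set {set 'I_n * gT}}) (i : 'I_n) (C : {set 'I_n * gT}).
Hypotheses (gpQ : is_partial_gpartition Q).
Hypothesis Qi : [disjoint cover Q & fiber i].
Hypothesis QC : C \in Q.

(* Gluing (i, 1) to C forces gluing (i, g) to translate g C. *)
Definition attach_to i C B := B :|: [set x in fiber i | translate x.2 C == B].
Definition attach i C Q := attach_to i C @: Q.

Lemma mem_attach_to B x : B \in Q ->
  (x \in attach_to i C B) = if x.1 == i then translate x.2 C == B else x \in B.
Proof.
move=> QB; rewrite !inE; case: eqP => [xi|_]; rewrite ?orbF //=.
by case xB: (x \in B) => //; have := notin_fiber Qi QB xB; rewrite xi eqxx.
Qed.

Lemma attach_toK B : B \in Q -> attach_to i C B :\: fiber i = B.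
Proof.
move=> QB; apply/setP => x; rewrite inE mem_attach_to // inE.
case: eqP => //= xi; apply/esym/negP => xB.
by have := notin_fiber Qi QB xB; rewrite xi eqxx.
Qed.

(** The new graphs are single-valued over [i] because the action is free: [(i, g)] and [(i, h)]
    share a block only if [translate g C = translate h C]. *)
Lemma attach_gpartition : is_partial_gpartition (attach i C Q).
Proof.
have /gpartitionP[tQ Q0 trQ funQ] := gpQ; apply/gpartitionP; split.
- move=> _ _ x /imsetP[B QB ->] /imsetP[D QD ->].
  rewrite !mem_attach_to //; case: eqP => [_ /eqP-> /eqP->|_ xB xD] //.
  by rewrite (tQ B D x).
- apply/imsetP => -[B QB /esym/eqP]; rewrite setU_eq0 => /andP[/eqP B0 _].
  by rewrite -B0 QB in Q0.
- move=> g _ /imsetP[B QB ->]; apply/imsetP; exists (translate g B); first exact: trQ.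
  apply/setP => x; rewrite mem_translate !mem_attach_to ?trQ //=.
  case: eqP => // _; last by rewrite mem_translate.
  by rewrite -translateM (can2_eq (translateKV _) (translateK _)).
- move=> _ x y /imsetP[B QB ->]; rewrite !mem_attach_to // => + + eqxy.
  rewrite -eqxy; case: eqP => [_ /eqP <- /eqP/(translate_inj gpQ QC)|_ xB yB].
    by case: x y eqxy => [j g] [j' g'] /= -> ->.
  exact: funQ QB xB yB eqxy.
Qed.

Lemma delete_attach : delete i (attach i C Q) = Q.
Proof.
have /gpartitionP[_ Q0 _ _] := gpQ.
apply/setP => B; apply/deleteP/idP => [[_ [_ /imsetP[D QD ->] ->]]|QB].
  by rewrite attach_toK.
split; first by apply: contraNneq Q0 => <-.
by exists (attach_to i C B); rewrite ?imset_f ?attach_toK.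
Qed.

Lemma attach_no_singleton : [set (i, 1)] \notin attach i C Q.
Proof.
have /gpartitionP[_ Q0 _ _] := gpQ.
apply/imsetP => -[B QB eqB]; have := attach_toK QB; rewrite -eqB => B0.
suff B0' : B = set0 by rewrite -B0' QB in Q0.
by rewrite -B0; apply/setP => -[j g]; rewrite !inE xpair_eqE; case: eqP.
Qed.

Lemma card_attach : #|attach i C Q| = #|Q|.
Proof.
by rewrite -(card_delete attach_gpartition attach_no_singleton) delete_attach.
Qed.

Lemma mem_attach1 : (i, 1) \in attach_to i C C.
Proof. by rewrite mem_attach_to //= eqxx translate1. Qed.

(** [C] can be read off from the block containing [(i, 1)], so gluing is injective in [C] as well as
    in [Q]. *)
Lemma pblock_attach : pblock (attach i C Q) (i, 1) :\: fiber i = C.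
Proof.
have /and4P[tA _ _ _] := attach_gpartition.
by rewrite (def_pblock tA _ mem_attach1) ?imset_f ?attach_toK.
Qed.

End Attach.

Lemma attach_delete P i : is_partial_gpartition P ->
    [set (i, 1)] \notin P -> (i, 1) \in cover P ->
  attach i (pblock P (i, 1) :\: fiber i) (delete i P) = P.
Proof.
move=> gpP noi Pi; have /gpartitionP[tP P0 trP _] := gpP.
set D := pblock P (i, 1); have PD : D \in P by rewrite pblock_mem.
have Di : (i, 1) \in D by rewrite mem_pblock.
have attachK B : B \in P -> attach_to i (D :\: fiber i) (B :\: fiber i) = B.
  move=> PB; apply/setP => -[j g]; rewrite !inE /=.
  (* Only points over [i] matter: [(i, g)] lies in [translate g D], hence in [B] exactly when [B] is
     that block. *)
  case: eqP => [->|_] /=; last by rewrite orbF.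
  have trD : translate g (D :\: fiber i) = translate g D :\: fiber i.
    by apply/setP => x; rewrite !(inE, mem_translate).
  have gD : (i, g) \in translate g D by rewrite mem_translate /= mulVg.
  rewrite trD; apply/eqP/idP => [/(setD_fiber_inj gpP noi) <- //|iB]; first exact: trP.
  by rewrite (tP B _ _ PB (trP g D PD) iB gD).
apply/setP => B; apply/imsetP/idP => [[_ /deleteP[_ [E PE ->]] ->]|PB].
  by rewrite attachK.
exists (B :\: fiber i); last by rewrite attachK.
by apply/deleteP; split; [apply: (setD_fiber_neq0 gpP noi) | exists B].
Qed.

(** Translation by [g^-1] moves [(i, g)] to [(i, 1)], so this one point decides whether [i] lies in
    the zero block. *)
Lemma disjoint_fiber P i : is_partial_gpartition P ->
  (i, 1) \notin cover P -> [disjoint cover P & fiber i].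
Proof.
move=> /gpartitionP[_ _ trP _] noi; apply/pred0P => -[j g] /=.
apply: contraNF noi; rewrite inE /= => /andP[/bigcupP[B PB jB] /eqP <-].
apply/bigcupP; exists (translate g^-1 B); first exact: trP.
by rewrite mem_translate invgK mulg1.
Qed.

Lemma delete_add_singletons Q i : is_partial_gpartition Q ->
  [disjoint cover Q & fiber i] -> delete i (Q :|: singletons i) = Q.
Proof.
move=> gpQ Qi; rewrite -[RHS](delete_id gpQ Qi).
apply/setP => B; apply/deleteP/deleteP => -[B0 [C QC eqB]]; split=> //; last first.
  by exists C; rewrite // inE QC.
case/setUP: QC => [QC|/singletonsP[g eqC]]; first by exists C.
case/set0Pn: B0 => x; rewrite eqB eqC => /setDP[/set1P eqx]; rewrite eqx.
by rewrite inE eqxx.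
Qed.

Lemma add_singletons_delete P i : is_partial_gpartition P ->
  [set (i, 1)] \in P -> delete i P :|: singletons i = P.
Proof.
move=> gpP Pi; have /gpartitionP[tP _ _ _] := gpP.
have sP := singletons_subset gpP Pi.
(* It suffices to compare supports once the left side is contained in [P]. Containment holds because
   each [(i, g)] is a block of its own, so a block with a point off the fiber has none over [i]. *)
apply: gpartition_cover_eq => //; first exact: isolate_gpartition.
- rewrite subUset sP andbT; apply/subsetP => D /deleteP[D0 [B PB eqD]].
  have [x] := set0Pn _ D0; rewrite eqD => /setDP[xB xi].
  suff -> : B :\: fiber i = B by [].
  apply/setP => -[j g]; rewrite !inE; case: eqP => //= ->; apply/esym/negP => iB.
  have Pg : [set (i, g)] \in P by apply: (subsetP sP); apply/singletonsP; exists g.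
  have eqBi := tP _ _ _ PB Pg iB (set11 _).
  by move: xB xi; rewrite eqBi => /set1P->; rewrite inE eqxx.
- apply/subsetP => x /bigcupP[B PB xB]; apply/bigcupP.
  have [xi|xi] := boolP (x \in fiber i).
    have : x \in cover (singletons i) by rewrite cover_singletons.
    by case/bigcupP => D sD xD; exists D; rewrite // inE sD orbT.
  exists (B :\: fiber i); last by rewrite inE xi.
  rewrite inE; apply/orP; left; apply/deleteP; split; last by exists B.
  by apply/set0Pn; exists x; rewrite inE xi.
Qed.

(** * Dowling's recurrence, by the position of one point *)

Lemma over_setD1 A i : over (A :\ i) = over A :\: fiber i.
Proof. by apply/setP => x; rewrite !inE. Qed.

Lemma fiber_over A i : i \in A -> fiber i \subset over A.
Proof. by move=> Ai; apply/subsetP => x; rewrite !inE => /eqP->. Qed.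

Lemma gpartitions_overP A k P : reflect
  [/\ is_partial_gpartition P, cover P \subset over A & #|P| = k * #|gT|]%N
  (P \in gpartitions_over A k).
Proof. by rewrite inE; apply: (iffP and3P) => -[? ? /eqP]. Qed.

Lemma cover_delete_over A i P :
  cover P \subset over A -> cover (delete i P) \subset over (A :\ i).
Proof. by move=> sPA; rewrite cover_delete over_setD1 setSD. Qed.

Lemma over_setD1_disjoint A i Q :
  cover Q \subset over (A :\ i) -> [disjoint cover Q & fiber i].
Proof. by rewrite over_setD1 subsetD => /andP[]. Qed.

Section Recurrence.
Variables (A : {set 'I_n}) (i : 'I_n) (k : nat).
Hypothesis Ai : i \in A.

Lemma card_uncovered :
  #|[set P in gpartitions_over A k | (i, 1) \notin cover P]|
  = #|gpartitions_over (A :\ i) k|.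
Proof.
apply: eq_card => P; rewrite inE.
apply/andP/gpartitions_overP => [[/gpartitions_overP[gpP sPA cardP] Pi]|].
  split=> //; rewrite over_setD1 subsetD sPA /=.
  exact: disjoint_fiber.
case=> gpP; rewrite over_setD1 subsetD => /andP[sPA dis] cardP.
split; first exact/gpartitions_overP.
by apply/negP => Pi; have := disjointFr dis Pi; rewrite inE eqxx.
Qed.

(** Adding and deleting the isolated point [i] are inverse to each other; the block count changes by
    one. *)
Lemma card_singleton_block :
  #|[set P in gpartitions_over A k.+1 | [set (i, 1)] \in P]|
  = #|gpartitions_over (A :\ i) k|.
Proof.
pose add Q := Q :|: singletons i.
have add_inj : {in gpartitions_over (A :\ i) k &, injective add}.
  apply: (can_in_inj (g := delete i)) => Q /gpartitions_overP[gpQ sQA _].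
  exact/delete_add_singletons/over_setD1_disjoint/sQA.
rewrite -(card_in_imset add_inj); apply: eq_card => P; rewrite inE.
apply/andP/imsetP => [[/gpartitions_overP[gpP sPA cardP] Pi]|].
  have def_P := add_singletons_delete gpP Pi.
  exists (delete i P); last by rewrite /add def_P.
  apply/gpartitions_overP; split; [exact: delete_gpartition| exact: cover_delete_over|].
  apply/eqP; rewrite -(eqn_add2r #|gT|) -(card_add_singletons (delete_disjoint i P)).
  by rewrite def_P cardP mulSn addnC.
case=> Q /gpartitions_overP[gpQ sQA cardQ] ->.
have Qi := over_setD1_disjoint sQA.
split; last by rewrite inE; apply/orP; right; apply/singletonsP; exists 1.
apply/gpartitions_overP; split; first exact: add_singletons_gpartition.
  rewrite /cover bigcup_setU subUset; apply/andP; split.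
    by apply: subset_trans sQA _; rewrite over_setD1 subsetDl.
  by rewrite -/(cover _) cover_singletons fiber_over.
by rewrite card_add_singletons // cardQ mulSn addnC.
Qed.

(** Such a [P] amounts to its deletion together with the graph to which [(i, 1)] is glued, one of
    the [k * #|gT|] members of the deletion. *)
Lemma card_attached :
  #|[set P in gpartitions_over A k
     | ((i, 1) \in cover P) && ([set (i, 1)] \notin P)]|
  = (k * #|gT| * #|gpartitions_over (A :\ i) k|)%N.
Proof.
pose D := [set QC : {set {set 'I_n * gT}} * {set 'I_n * gT}
           | (QC.1 \in gpartitions_over (A :\ i) k) && (QC.2 \in QC.1)].
transitivity #|D|; last first.
  rewrite -sum1dep_card.
  rewrite -(pair_big_dep (mem (gpartitions_over (A :\ i) k))
              (fun Q C => C \in Q) (fun _ _ => 1%N)) /= mulnC -sum_nat_const.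
  by apply: eq_bigr => Q /gpartitions_overP[_ _ <-]; rewrite sum1_card.
pose glue (QC : {set {set 'I_n * gT}} * {set 'I_n * gT}) := attach i QC.2 QC.1.
have glue_inj : {in D &, injective glue}.
  apply: (can_in_inj (g := fun P => (delete i P, pblock P (i, 1) :\: fiber i))).
  move=> [Q C]; rewrite inE => /andP[/gpartitions_overP[gpQ sQA _] /= QC].
  have Qi := over_setD1_disjoint sQA.
  by rewrite /glue /= delete_attach // pblock_attach.
rewrite -(card_in_imset glue_inj); apply: eq_card => P; rewrite inE.
apply/andP/imsetP => [[/gpartitions_overP[gpP sPA cardP] /andP[Pi noi]]|].
  exists (delete i P, pblock P (i, 1) :\: fiber i); last first.
    by rewrite /glue attach_delete.
  rewrite inE /=; apply/andP; split.
    apply/gpartitions_overP; split; last by rewrite card_delete.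
      exact: delete_gpartition.
    exact: cover_delete_over.
  have PB : pblock P (i, 1) \in P by rewrite pblock_mem.
  apply/deleteP; split; last by exists (pblock P (i, 1)).
  exact: setD_fiber_neq0 gpP noi _ PB.
case=> -[Q C]; rewrite inE => /andP[/gpartitions_overP[gpQ sQA cardQ] /= QC ->].
have Qi := over_setD1_disjoint sQA; rewrite /glue /=.
have gpA := attach_gpartition gpQ Qi QC.
split; last first.
  rewrite attach_no_singleton // andbT; apply/bigcupP.
  exists (attach_to i C C); first exact: imset_f.
  exact: mem_attach1 Qi QC.
apply/gpartitions_overP; split; rewrite ?card_attach //.
have := cover_delete i (attach i C Q); rewrite delete_attach // => eqc.
apply/subsetP => x xA; have [xi|xi] := boolP (x \in fiber i).
  exact: (subsetP (fiber_over Ai)).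
have : x \in over (A :\ i) by apply: (subsetP sQA); rewrite eqc inE xi.
by rewrite over_setD1 => /setDP[].
Qed.

End Recurrence.

(** The point [i] is in the zero block (factor 1), isolated (the term with [k]), or glued to a
    larger block (factor [#|gT| * k.+1]). *)
Lemma card_gpartitions_overS A i k : i \in A ->
  #|gpartitions_over A k.+1|
  = ((1 + #|gT| * k.+1) * #|gpartitions_over (A :\ i) k.+1|
     + #|gpartitions_over (A :\ i) k|)%N.
Proof.
move=> Ai.
pose covered := [set P : {set {set 'I_n * gT}} | (i, 1) \in cover P].
pose isolated := [set P : {set {set 'I_n * gT}} | [set (i, 1)] \in P].
rewrite -(cardsID covered).
have -> : gpartitions_over A k.+1 :\: covered
          = [set P in gpartitions_over A k.+1 | (i, 1) \notin cover P].
  by apply/setP => P; rewrite !inE andbC.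
rewrite card_uncovered // -(cardsID isolated).
set X := _ :&: _ :&: _; set Y := _ :\: _.
have -> : X = [set P in gpartitions_over A k.+1 | [set (i, 1)] \in P].
  apply/setP => P; rewrite !inE -!andbA.
  case Pi: ([set (i, 1)] \in P); rewrite ?andbF // !andbT.
  suff -> : (i, 1) \in cover P by rewrite andbT.
  by apply/bigcupP; exists [set (i, 1)]; rewrite ?inE.
have -> : Y = [set P in gpartitions_over A k.+1
               | ((i, 1) \in cover P) && ([set (i, 1)] \notin P)].
  by apply/setP => P; rewrite !inE andbC -!andbA.
rewrite card_singleton_block // card_attached //; lia.
Qed.

Lemma card_gpartitions_over0 A : #|gpartitions_over A 0| = 1%N.
Proof.
rewrite -(cards1 (set0 : {set {set 'I_n * gT}})); apply: eq_card => P.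
rewrite in_set1; apply/gpartitions_overP/eqP => [[_ _ /eqP]|->].
  by rewrite mul0n cards_eq0 => /eqP.
split; [exact: set0_gpartition | | by rewrite cards0].
by apply/subsetP => x /bigcupP[B]; rewrite inE.
Qed.

Lemma card_gpartitions_over_set0 k : #|gpartitions_over set0 k.+1| = 0%N.
Proof.
apply: eq_card0 => P; apply/negP => /gpartitions_overP[gpP sP cardP].
have /gpartitionP[_ P0 _ _] := gpP.
have : 0 < #|P| by rewrite cardP muln_gt0 cardG_gt0.
case/card_gt0P => B PB.
have [B0|[x xB]] := set_0Vmem B; first by rewrite B0 (negPf P0) in PB.
suff : x \in over set0 by rewrite !inE.
by apply/(subsetP sP)/bigcupP; exists B.
Qed.

End PartialGPartitions.

(** * The numerical recurrence and the three polynomial sequences *)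

Fixpoint whitney_number (m n k : nat) : nat :=
  match n, k with
  | _, 0 => 1
  | 0, _.+1 => 0
  | n'.+1, k'.+1 =>
      (1 + m * k'.+1) * whitney_number m n' k'.+1 + whitney_number m n' k'
  end.

Lemma card_gpartitions_over (n : nat) (gT : finGroupType) (A : {set 'I_n}) k :
  #|gpartitions_over gT A k| = whitney_number #|gT| #|A| k.
Proof.
have [a cardA] : exists a, #|A| = a by exists #|A|.
rewrite cardA; elim: a A cardA k => [|a IHa] A cardA [|k].
- exact: card_gpartitions_over0.
- by move/eqP: cardA; rewrite cards_eq0 => /eqP->; apply: card_gpartitions_over_set0.
- exact: card_gpartitions_over0.
- have [i Ai] : exists i, i \in A by apply/card_gt0P; rewrite cardA.
  have cardAi : #|A :\ i| = a by move: cardA; rewrite (cardsD1 i) Ai => -[].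
  by rewrite (card_gpartitions_overS _ _ Ai) !(IHa _ cardAi).
Qed.

Lemma whitney_dowling_number (gT : finGroupType) n k :
  whitney_dowling gT n k = whitney_number #|gT| n k.
Proof. by rewrite whitney_dowlingE card_gpartitions_over cardsT card_ord. Qed.

Lemma whitney_number_gt m n k : n < k -> whitney_number m n k = 0.
Proof.
by elim: n k => [|n IHn] [|k] //= lt_nk; rewrite !IHn ?muln0 // ltnW.
Qed.

Section WeightedWhitney.
Local Open Scope ring_scope.

(** Multiplying Dowling's recurrence by [c k] and writing [c k] as [(b0 + b1 k) c (k - 1)] gives a
    triangular array with weights [1 + m k] and [b0 + b1 k]. *)
Lemma weighted_whitney_strongly_q_log_convex (R : realType) (m b0 b1 : nat)
    (c : nat -> nat) :
    c 0 = 1%N -> (forall k, c k.+1 = (b0 + b1 * k.+1) * c k)%N ->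
  strongly_q_log_convex (fun n =>
    \sum_(k < n.+1) (c k * whitney_number m n k)%:R *: 'X^k : {poly R}).
Proof.
move=> c0 cS; set f := (f in strongly_q_log_convex f).
(* The formula also holds beyond the summation range, where the Whitney numbers vanish. *)
have coef_f n k : (f n)`_k = (c k * whitney_number m n k)%:R.
  rewrite /f -(poly_def n.+1 (fun k => (c k * whitney_number m n k)%:R)) coef_poly.
  by case: ltnP => // lt_nk; rewrite whitney_number_gt // muln0.
apply: (triangular_strongly_q_log_convex (a0 := 1) (a1 := m%:R)
          (b0 := b0%:R) (b1 := b1%:R)); rewrite ?ler0n ?ler01 //.
  by apply/polyP => -[|k]; rewrite coef_f coef1 ?c0 //= muln0.
move=> n [|k]; rewrite /= !coef_f.
  by case: n => [|n] /=; rewrite !mulr0 addr0 addr0 mul1r.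
rewrite -[X in (X + _) * _](mulr1n 1) -!natrM -!natrD -!natrM -!natrD.
by congr _%:R; rewrite cS [whitney_number m n.+1 k.+1]/=; ring.
Qed.

End WeightedWhitney.

Theorem corollary3p4 (R : realType) (m : nat) (hm : (1 <= m)%N)
    (gT : finGroupType) (hG : #|gT| = m) :
  strongly_q_log_convex (fun n => dowling_poly R gT n) /\
  strongly_q_log_convex (fun n => dowling_F1 R gT m n) /\
  strongly_q_log_convex (fun n => dowling_F2 R gT n).
Proof.
have transfer (c : nat -> nat) (f : nat -> {poly R}) b0 b1 :
    c 0 = 1 -> (forall k, c k.+1 = (b0 + b1 * k.+1) * c k) ->
    (forall n, f n = \sum_(k < n.+1) (c k * whitney_number m n k)%:R *: 'X^k)%R ->
  strongly_q_log_convex f.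
  move=> c0 cS eq_f n l l_gt0 le_ln; rewrite !eq_f.
  exact: (weighted_whitney_strongly_q_log_convex R m c0 cS).
(* The ratios [c k.+1 / c k] are [1], [m (k + 1)] and [k + 1], so the pairs [b0], [b1] are [1, 0],
   then [0, m], then [0, 1]. *)
split; [|split].
- apply: (transfer (fun=> 1) _ 1 0) => // n; apply: eq_bigr => k _.
  by rewrite whitney_dowling_number hG mul1n.
- apply: (transfer (fun k => k`! * m ^ k) _ 0 m) => [//|k|n].
    by rewrite factS expnS; lia.
  by apply: eq_bigr => k _; rewrite whitney_dowling_number hG mulnAC.
- apply: (transfer factorial _ 0 1) => [//|k|n]; first by rewrite factS mul1n.
  by apply: eq_bigr => k _; rewrite whitney_dowling_number hG.
Qed.
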